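(* Let $T$ be a finite tree with diameter at least $3$ and maximum degree $\Delta \ge 3$, or an infinite tree with finite maximum degree $\Delta \ge 3$. Then, for any integers $h, p \ge 1$ such that $h \ge \Delta p$, $$2h + (\Delta - 1)p \le \sigma_{h,p,p}(T) \le \sigma^*_{h,p,p}(T) \le 2h + \Delta p - 1.$$ In particular, for integers $m,k\ge2$, if $T = T_{m,k}$, $T_{m,\infty}$, $\hat{T}_{m,k}$ or $\hat{T}_{m,\infty}$ and $h \ge (m+1)p$, then $$2h+mp \le \sigma_{h,p,p}(T) \le \sigma^*_{h,p,p}(T) \le 2h+(m+1)p-1.$$
   Context: Infinite graphs have countably infinitely many vertices. $N(u)$ is the neighbourhood of $u$ and $d(u,v)$ the distance between $u$ and $v$. For a positive integer $\ell$, $|x|_\ell=\min\{|x|,\ell-|x|\}$. A $C(h_1,h_2,h_3)$-labelling of a graph $G$ with span $\ell$ is a mapping $f: V(G)\to\{0,1,\ldots,\ell-1\}$ such that for $i=1,2,3$ and any $u,v\in V(G)$ with $d(u,v)=i$ we have $|f(u)-f(v)|_\ell\ge h_i$. $\sigma_{h_1,h_2,h_3}(G)$ is the minimum integer $\ell$ such that $G$ admits a $C(h_1,h_2,h_3)$-labelling with span $\ell$. An interval modulo $\ell$ is a set of the form $\{a \bmod \ell, (a+1) \bmod \ell, \ldots, b \bmod \ell\}$ (going cyclically from $a$ to $b$). A $C(h_1,h_2,h_3)$-labelling $f$ with span $\ell$ is elegant if for every vertex $u$ there is an interval $I_u$ modulo $\ell$ such that $f(N(u))\subseteq I_u$, and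 for every edge $uv$, $I_u\cap I_v=\emptyset$. $\sigma^*_{h_1,h_2,h_3}(G)$ is the minimum $\ell$ such that $G$ admits an elegant $C(h_1,h_2,h_3)$-labelling with span $\ell$ ($\infty$ if none exists). $T_{m,k}$ is the complete $m$-ary tree of height $k$: the rooted tree in which every non-leaf vertex has exactly $m$ children and all leaves are at level (distance from the root) $k$. $T_{m,\infty}$ is the infinite complete $m$-ary tree: the rooted tree with countably infinitely many vertices in which every vertex (including the root) has exactly $m$ children. $\hat{T}_{m,\infty}$ is the infinite $(m+1)$-regular tree, and $\hat{T}_{m,k}$ is its finite subtree induced by all vertices at distance at most $k$ from a fixed vertex. *)

(* Defs.v *)
From mathcomp Require Import all_boot all_order all_algebra.
From mathcomp Require Export boolp classical_sets cardinality constructive_ereal.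

Set Implicit Arguments.
Unset Strict Implicit.
Unset Printing Implicit Defensive.

Import Order.TTheory GRing.Theory Num.Theory.
Local Open Scope classical_set_scope.
Local Open Scope ring_scope.
Local Open Scope ereal_scope.

(* Simple graphs, finite or infinite. The vertex type is a countType, so an
   infinite graph has countably infinitely many vertices; the boolean adjacency
   relation is no restriction, since excluded middle is available. *)
Record graph := Graph {
  vertex :> countType;
  adj : rel vertex;
  adj_sym : symmetric adj;
  adj_irr : irreflexive adj
}.

(* The least element of a set of natural numbers, +oo if the set is empty. *)
Definition emin (P : set nat) : \bar int :=
  if pselect (exists n, `[< P n >]) is left ex then (ex_minn ex)%:Z%:E
  else +oo.

Section Graphs.
Variable G : graph.
Implicit Types u v r : G.

Definition finite_graph := finite_set [set: G].
Definition infinite_graph := infinite_set [set: G].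

Definition nbhd u : set G := [set v | adj u v].

Definition walk u v (n : nat) :=
  exists p : seq G, [/\ path (@adj G) u p, last u p = v & size p = n].

Definition dist u v : \bar int := emin [set n | walk u v n].

(* The least upper bound of all distances. *)
Definition diameter : \bar int :=
  emin [set n | forall u v, dist u v <= n%:Z%:E].

Definition max_degree (D : nat) :=
  (exists v, (nbhd v #= `I_D)%card) /\ (forall v, (nbhd v #<= `I_D)%card).

Definition connected := forall u v, exists n, walk u v n.

(* A cycle has at least three vertices: in a simple graph, the two ends of an
   edge already satisfy [ucycle]. *)
Definition acyclic := forall c : seq G, ucycle (@adj G) c -> (size c <= 2)%N.

Definition is_tree := connected /\ acyclic.

(* Rooted trees: the level of a vertex is its distance from the root, and its
   children are its neighbours on the next level. *)
Definition level r v := dist r v.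
Definition children r v : set G :=
  [set w | adj v w /\ level r w = level r v + 1].
Definition leaf r v := children r v = set0.

Section Labellings.
Variable l : nat.

(* |x|_l *)
Definition cnorm (x : int) : int := Num.min `|x|%R (l%:Z - `|x|)%R.

Definition labelling (h1 h2 h3 : nat) (f : G -> 'I_l) :=
  forall u v,
    [/\ dist u v = 1%:Z%:E -> (h1%:Z <= cnorm ((f u)%:Z - (f v)%:Z))%R,
        dist u v = 2%:Z%:E -> (h2%:Z <= cnorm ((f u)%:Z - (f v)%:Z))%R
      & dist u v = 3%:Z%:E -> (h3%:Z <= cnorm ((f u)%:Z - (f v)%:Z))%R].

(* {a mod l, (a+1) mod l, ..., b mod l}; the case where a cyclic walk from a to
   b passes through 0 is obtained by replacing b with b + l. *)
Definition interval_mod (I : set 'I_l) :=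
  exists a b : int, (a <= b)%R /\
    I = [set x | exists2 j : int, (a <= j <= b)%R & (x : nat)%:Z = (j %% l)%Z].

Definition elegant (f : G -> 'I_l) :=
  exists I : G -> set 'I_l,
    (forall u, interval_mod (I u) /\ f @` nbhd u `<=` I u) /\
    (forall u v, adj u v -> I u `&` I v = set0).

End Labellings.

Definition sigma (h1 h2 h3 : nat) : \bar int :=
  emin [set l | (0 < l)%N /\ exists f : G -> 'I_l, labelling h1 h2 h3 f].

Definition sigma_star (h1 h2 h3 : nat) : \bar int :=
  emin [set l | (0 < l)%N /\
    exists f : G -> 'I_l, labelling h1 h2 h3 f /\ elegant f].

End Graphs.

Section Induced.
Variables (G : graph) (P : pred G).

Definition induced_adj : rel {v : G | P v} :=
  fun u v => adj (val u) (val v).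

Lemma induced_adj_sym : symmetric induced_adj.
Proof. by move=> u v; rewrite /induced_adj adj_sym. Qed.

Lemma induced_adj_irr : irreflexive induced_adj.
Proof. by move=> u; rewrite /induced_adj adj_irr. Qed.

Definition induced := Graph induced_adj_sym induced_adj_irr.

End Induced.

Definition ball (G : graph) (c : G) (k : nat) : graph :=
  @induced G (fun v => `[< dist c v <= k%:Z%:E >]).

(* T is (isomorphic to) T_{m,k} *)
Definition is_T_fin (m k : nat) (T : graph) :=
  [/\ is_tree T, finite_graph T & exists r : T,
      (forall v, ~ leaf r v -> (children r v #= `I_m)%card) /\
      (forall v, leaf r v -> level r v = k%:Z%:E)].

(* T is (isomorphic to) T_{m,oo} *)
Definition is_T_inf (m : nat) (T : graph) :=
  [/\ is_tree T, infinite_graph T & exists r : T,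
      forall v, (children r v #= `I_m)%card].

(* T is (isomorphic to) \hat T_{m,oo}, the infinite (m+1)-regular tree *)
Definition is_hatT_inf (m : nat) (T : graph) :=
  [/\ is_tree T, infinite_graph T & forall v : T, (nbhd v #= `I_m.+1)%card].

(* T is \hat T_{m,k} *)
Definition is_hatT_fin (m k : nat) (T : graph) :=
  exists (H : graph) (c : H), is_hatT_inf m H /\ T = ball c k.

(* Main.v *)
Require Import Defs.
From mathcomp Require Import all_boot all_order all_algebra.
From mathcomp Require Import functions.
From mathcomp Require Import zify ring.

(** Write [D] for the maximum degree of the tree.

    Lower bound.  Let [v] have degree [D] and measure the labels of its
    neighbours cyclically from the label of [v].  They lie between [h] and
    [l - h], and since two neighbours are at distance two (a tree has no
    triangle) they are pairwise [p] apart; hence [(D - 1) * p <= l - 2 * h].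
    This is [star_span].

    Upper bound.  The labelling with span [l = 2 * h + D * p - 1] is the
    reduction modulo [l] of an integer valued one.  Split the tree into its two
    bipartition classes and suppose that [c] maps the vertices to integers so
    that [0 <= c v - c u <= D - 1] for an edge [uv] with [u] in the first class,
    and that [c] separates the neighbours of each vertex.  Put [F v = p * c v]
    on the first class and [F v = p * c v + h] on the second.  With
    [W = (D - 1) * p], the difference [F v - F u] is
     - between [h] and [h + W] on an edge [uv] with [u] in the first class,
     - between [p] and [W] in absolute value at distance two, because both values
       lie in one window of length [W],
     - between [h - W] and [h + 2 * W] along a walk of length three from the first
       class to the second.
    As [W + p <= h] and [l = 2 * h + W + p - 1], each of these ranges is within
    what a cyclic distance of [h], respectively [p], allows.  Reduced modulo [l],
    the windows [F u + h, ..., F u + h + W] for [u] in the first class and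
    [F v - h - W, ..., F v - h] for [v] in the second are the intervals that make
    the labelling elegant: for an edge they are disjoint by the estimate on walks
    of length three, which holds for all points of the windows.

    The map [c] exists ([tree_colouring]).  Number the at most [D] neighbours of
    each vertex [u] injectively by [s u] with values below [D].  Starting at a root,
    colour the children [v] of [u] by the number congruent to [K + s u v] modulo [D]
    in the window prescribed by the colour of [u], where the constant [K] is such
    that the parent of [u] fits the same formula.  The neighbours of [u] then
    get distinct residues modulo [D].  That every non-root vertex has a single
    neighbour on a lower level and none on its own level is where acyclicity
    enters ([path_below_level]).

    In the complete [m]-ary and [(m + 1)]-regular trees the maximum degree is
    [m + 1], attained at a child of the root, respectively at the centre. *)

Set Implicit Arguments.
Unset Strict Implicit.
Unset Printing Implicit Defensive.

Import Order.TTheory GRing.Theory Num.Theory.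
Local Open Scope ring_scope.

(** * Distances as lengths of shortest walks *)

Section Minima.
Local Open Scope classical_set_scope.
Local Open Scope ereal_scope.
Implicit Types (P : set nat) (n : nat).

Lemma emin_le P n : P n -> emin P <= n%:Z%:E.
Proof.
move=> Pn; rewrite /emin; case: pselect => [ex|[]]; last first.
  by exists n; apply/asboolP.
by case: ex_minnP => m _ m_min; rewrite lee_fin lez_nat m_min//; apply/asboolP.
Qed.

Lemma le_emin P (z : \bar int) :
  (forall n, P n -> z <= n%:Z%:E) -> z <= emin P.
Proof.
move=> le_z; rewrite /emin; case: pselect => [ex|_]; last by rewrite leey.
by case: ex_minnP => m /asboolP Pm _; apply: le_z.
Qed.

Lemma emin_attained P n : emin P = n%:Z%:E -> P n.
Proof.
rewrite /emin; case: pselect => [ex|//].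
by case: ex_minnP => m /asboolP Pm _ [<-].
Qed.

Lemma emin_eq P n : P n -> (forall k, P k -> (n <= k)%N) -> emin P = n%:Z%:E.
Proof.
move=> Pn n_min; apply/eqP; rewrite eq_le emin_le//=.
by apply: le_emin => k Pk; rewrite lee_fin lez_nat n_min.
Qed.

End Minima.

Section Walks.
Local Open Scope ereal_scope.
Variable G : graph.
Implicit Types u v w : G.

Lemma adj_neq u v : adj u v -> u != v.
Proof. by apply: contraTneq => ->; rewrite adj_irr. Qed.

Lemma walk0 u : walk u u 0.
Proof. by exists [::]. Qed.

Lemma walk0_eq u v : walk u v 0 -> v = u.
Proof. by case=> p [_ <- /size0nil->]. Qed.

Lemma walkS u v n : walk u v n.+1 <-> exists2 w, walk u w n & adj w v.
Proof.
split=> [[p []]|[w [p [up lp sp]] wv]].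
  elim/last_ind: p => [//|p x _]; rewrite rcons_path last_rcons size_rcons.
  by move=> /andP[up xv] <- [sp]; exists (last u p) => //; exists p.
by exists (rcons p v); rewrite rcons_path last_rcons size_rcons up lp sp.
Qed.

Lemma walk1 u v : walk u v 1 -> adj u v.
Proof. by case/walkS=> w /walk0_eq->. Qed.

Lemma walk_cat u v w n m : walk u v n -> walk v w m -> walk u w (n + m).
Proof.
move=> [p [up lp sp]] [q [vq lq sq]]; exists (p ++ q).
by rewrite cat_path last_cat size_cat up lp vq lq sp sq.
Qed.

Lemma walk_sym u v n : walk u v n -> walk v u n.
Proof.
elim: n v => [|n IHn] v; first by move/walk0_eq->; apply: walk0.
move=> /walkS[w /IHn wu wv]; rewrite -add1n; apply: walk_cat wu.
by apply/walkS; exists v; [exact: walk0|rewrite adj_sym].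
Qed.

Lemma dist_walk u v n : dist u v = n%:Z%:E -> walk u v n.
Proof. exact: emin_attained. Qed.

Lemma dist_refl u : dist u u = 0%:Z%:E.
Proof. by apply: emin_eq; first exact: walk0. Qed.

Lemma dist_adj u v : adj u v -> dist u v = 1%:Z%:E.
Proof.
move=> uv; apply: emin_eq => [|[|k]//=].
  by apply/walkS; exists u => //; apply: walk0.
by move/walk0_eq => e; move: uv; rewrite e adj_irr.
Qed.

Lemma dist2 u v w : adj w u -> adj w v -> u != v -> ~~ adj u v ->
  dist u v = 2%:Z%:E.
Proof.
move=> wu wv uv nuv; apply: emin_eq => [|[|[|k]]//=].
- apply/walkS; exists w => //; apply/walkS; exists u; first exact: walk0.
  by rewrite adj_sym.
- by move/walk0_eq => e; rewrite e eqxx in uv.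
- by move/walk1; rewrite (negbTE nuv).
Qed.

End Walks.

(** * Levels and parents in a rooted tree *)

Section RootedTree.
Variables (G : graph) (r : G).
Hypothesis G_tree : is_tree G.
Implicit Types u v w : G.

Let walk_from_root v : exists n, `[< walk r v n >].
Proof. by have [n w] := G_tree.1 r v; exists n; apply/asboolP. Qed.

Definition lev v : nat := ex_minn (walk_from_root v).

Lemma lev_walk v : walk r v (lev v).
Proof. by rewrite /lev; case: ex_minnP => n /asboolP. Qed.

Lemma lev_le v n : walk r v n -> (lev v <= n)%N.
Proof. by move=> w; rewrite /lev; case: ex_minnP => m _; apply; apply/asboolP. Qed.

Lemma level_lev v : level r v = (lev v)%:Z%:E.
Proof. by apply: emin_eq => [|k]; [exact: lev_walk|exact: lev_le]. Qed.

Lemma lev_root : lev r = 0%N.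
Proof. by apply/eqP; rewrite -leqn0 lev_le//; apply: walk0. Qed.

Lemma lev_eq0 v : lev v = 0%N -> v = r.
Proof. by move=> e; apply: walk0_eq; rewrite -e; apply: lev_walk. Qed.

Lemma lev_adj u v : adj u v -> (lev v <= (lev u).+1)%N.
Proof. by move=> uv; apply/lev_le/walkS; exists u => //; apply: lev_walk. Qed.

Lemma lower_neighbour v n : lev v = n.+1 -> exists2 u, adj u v & lev u = n.
Proof.
move=> e; have := lev_walk v; rewrite e => /walkS[u ru uv]; exists u => //.
by have := lev_adj uv; have := lev_le ru; lia.
Qed.

(** Descending from two distinct vertices of a level until the descents meet
    gives a path below that level.  Any edge or further vertex joining its ends
    closes it into a cycle, which is how acyclicity is used. *)
Lemma path_below_level n u w : lev u = n -> lev w = n -> u != w ->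
  exists p, [/\ path (@adj G) u p, last u p = w, uniq (u :: p),
               all (fun x => lev x <= n)%N (u :: p) & (1 < size p)%N].
Proof.
elim: n u w => [|n IHn] u w eu ew neq_uw.
  by rewrite (lev_eq0 eu) (lev_eq0 ew) eqxx in neq_uw.
have [u' u'u eu'] := lower_neighbour eu.
have [w' w'w ew'] := lower_neighbour ew.
have [e|neq'] := eqVneq u' w'.
  exists [:: u'; w]; rewrite /= !inE eu ew eu' leqnn leqnSn adj_sym u'u e w'w.
  rewrite negb_or neq_uw !andbT; split=> //.
  by rewrite (adj_neq w'w) -e eq_sym (adj_neq u'u).
have [p [pp lp up /allP ap sp]] := IHn _ _ eu' ew' neq'.
have high x : lev x = n.+1 -> x \notin u' :: p.
  by move=> ex; apply/negP => /ap; rewrite ex ltnn.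
exists (u' :: rcons p w); split.
- by rewrite /= rcons_path pp lp w'w adj_sym u'u.
- by rewrite /= last_rcons.
- rewrite -rcons_cons cons_uniq rcons_uniq mem_rcons in_cons negb_or neq_uw.
  by rewrite high// high.
- apply/allP=> x; rewrite -rcons_cons in_cons mem_rcons in_cons.
  by case/or3P=> [/eqP->|/eqP->|/ap/leqW//]; rewrite ?eu ?ew.
- by rewrite /= size_rcons; lia.
Qed.

(** The edge closes the path below the level of its ends into a cycle. *)
Lemma lev_adj_neq u w : adj u w -> lev u != lev w.
Proof.
move=> uw; apply/eqP => e.
have [p [pp lp up _ sp]] := path_below_level (erefl _) (esym e) (adj_neq uw).
have := G_tree.2 (u :: p); rewrite /ucycle /= rcons_path pp lp adj_sym uw.
by move=> /(_ up); lia.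
Qed.

(** The common upper neighbour closes the path between its lower neighbours. *)
Lemma lower_neighbour_uniq v u w : adj u v -> adj w v ->
  lev v = (lev u).+1 -> lev v = (lev w).+1 -> u = w.
Proof.
move=> uv wv eu ew; apply/eqP/negP => /negP neq.
have ewu : lev w = lev u by lia.
have [p [pp lp up /allP ap sp]] := path_below_level (erefl _) ewu neq.
have vp : v \notin u :: p by apply/negP => /ap; rewrite eu ltnn.
have := G_tree.2 (v :: u :: p).
rewrite /ucycle cons_uniq vp up /= rcons_path pp lp wv adj_sym uv.
by move=> /(_ isT) /=; lia.
Qed.

(** The root is its own parent: the colouring below needs a total parent map,
    and at the root any constant serves. *)
Definition par v : G :=
  xget r [set u | adj u v /\ lev v = (lev u).+1]%classic.

Lemma par_root : par r = r.
Proof. by apply: xgetPN => u -[_]; rewrite lev_root. Qed.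

Lemma par_adj v : v != r -> adj (par v) v /\ lev v = (lev (par v)).+1.
Proof.
move=> vr; rewrite /par; case: xgetP => [u -> []//|nopar].
case e : (lev v) => [|n]; first by rewrite (lev_eq0 e) eqxx in vr.
by have [u uv eu] := lower_neighbour e; case: (nopar u); split; rewrite // eu.
Qed.

Lemma adj_par u v : adj u v -> (v != r /\ par v = u) \/ (u != r /\ par u = v).
Proof.
move=> uv; wlog lt_uv : u v uv / (lev u < lev v)%N => [IH|].
  case: (ltngtP (lev u) (lev v)) (lev_adj_neq uv) => // lt _; first exact: IH.
  by have vu : adj v u by [rewrite adj_sym]; case: (IH v u vu lt); auto.
left; have vr : v != r by apply: contraTneq lt_uv => ->; rewrite lev_root.
have [pv ev] := par_adj vr; split=> //; apply: (lower_neighbour_uniq pv uv ev).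
by have := lev_adj uv; lia.
Qed.

Lemma odd_lev_adj u v : adj u v -> odd (lev v) = ~~ odd (lev u).
Proof.
case/adj_par=> -[nr e]; have [_] := par_adj nr; rewrite e => -> //=.
by rewrite negbK.
Qed.

Lemma lev_par v : (lev (par v) <= lev v)%N.
Proof.
by have [->|/par_adj[_ ->]] := eqVneq v r; rewrite ?par_root ?leqnSn.
Qed.

(** * An integer colouring with narrow windows at edges *)

Section Colouring.
Variables (D : nat) (s : G -> G -> nat).
Hypothesis D_gt0 : (0 < D)%N.
Implicit Types (x y : int) (n : nat).

(** The number congruent to [y] modulo [D] among the [D] consecutive ones that
    begin (if [up]) or end (otherwise) at [x]. *)
Definition snap (up : bool) x y : int :=
  if up then x + ((y - x) %% D%:Z)%Z else x - ((x - y) %% D%:Z)%Z.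

Lemma snap_window up x y :
  0 <= (if up then snap up x y - x else x - snap up x y) <= D%:Z - 1.
Proof.
have D0 : 0 < D%:Z by rewrite ltz_nat.
case: up; rewrite /snap.
  by have := ltz_pmod (y - x) D0; have := @modz_ge0 (y - x) D%:Z; lia.
by have := ltz_pmod (x - y) D0; have := @modz_ge0 (x - y) D%:Z; lia.
Qed.

Lemma snap_mod up x y : exists q : int, snap up x y = y + q * D%:Z.
Proof.
case: up; rewrite /snap.
  by exists (- ((y - x) %/ D%:Z)%Z); have := divz_eq (y - x) D%:Z; lia.
by exists ((x - y) %/ D%:Z)%Z; have := divz_eq (x - y) D%:Z; lia.
Qed.

(** The colours of a vertex [v] with parent [u] and of the parent of [u] differ
    by [s u v - s u (par u)] modulo [D], so that around [u] colours reproduce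
    the numbering [s u] up to a constant.  The recursion follows the parents,
    [n] bounding its depth. *)
Fixpoint colour_upto n v : int :=
  if v == r then 0 else
  if n is n'.+1 then
    snap (~~ odd (lev (par v))) (colour_upto n' (par v))
      (colour_upto n' (par (par v))
       + (s (par v) v)%:Z - (s (par v) (par (par v)))%:Z)
  else 0.

Lemma colour_upto_eq n m v : (lev v <= n)%N -> (lev v <= m)%N ->
  colour_upto n v = colour_upto m v.
Proof.
elim: n m v => [|n IHn] m v ln lm.
  have -> : v = r by apply: lev_eq0; lia.
  by case: m {lm} => /=; rewrite eqxx.
have [->|vr] := eqVneq v r; first by case: m {lm} => /=; rewrite eqxx.
have [_ ev] := par_adj vr; have lpp := lev_par (par v).
case: m lm => [|m] lm; first by lia.
by rewrite /= (negbTE vr) (IHn m (par v)) ?(IHn m (par (par v)))//; lia.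
Qed.

Definition colour v := colour_upto (lev v) v.

Lemma colourE v : v != r -> colour v =
  snap (~~ odd (lev (par v))) (colour (par v))
    (colour (par (par v)) + (s (par v) v)%:Z - (s (par v) (par (par v)))%:Z).
Proof.
move=> vr; have [_ ev] := par_adj vr; rewrite {1}/colour ev /= (negbTE vr).
have E a : (lev a <= lev (par v))%N ->
  colour_upto (lev (par v)) a = colour a by move=> la; apply: colour_upto_eq.
by rewrite !E// lev_par.
Qed.

Lemma colour_window u v : adj u v -> ~~ odd (lev u) ->
  0 <= colour v - colour u <= D%:Z - 1.
Proof.
move=> uv eu; case: (adj_par uv) => -[nr e].
  rewrite [colour v]colourE// e eu; exact: (snap_window true).
have ov : ~~ odd (lev v) = false by rewrite (odd_lev_adj uv) eu.
rewrite [colour u]colourE// e ov; exact: (snap_window false).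
Qed.

(** For a child [v] of [u] this is how the colour was chosen; for the parent
    [v] of [u] the two numbers cancel and the quotient is zero. *)
Lemma colour_mod u v : adj u v -> exists q : int, colour v =
  colour (par u) + (s u v)%:Z - (s u (par u))%:Z + q * D%:Z.
Proof.
move=> uv; case: (adj_par uv) => -[nr e]; last by exists 0; rewrite e; lia.
by rewrite colourE// e; apply: snap_mod.
Qed.

Lemma colour_neq u v w :
  (forall a, adj u a -> (s u a < D)%N) ->
  (forall a b, adj u a -> adj u b -> s u a = s u b -> a = b) ->
  adj u v -> adj u w -> v != w -> colour v != colour w.
Proof.
move=> sD s_inj uv uw; apply: contraNneq => e; apply/eqP/s_inj => //.
have [[q eq] [q' eq']] := (colour_mod uv, colour_mod uw).
have [sv sw] := (sD _ uv, sD _ uw).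
have : (s u v)%:Z - (s u w)%:Z = (q' - q) * D%:Z by move: eq eq'; rewrite e; lia.
by have [->|[?|?]] : q' - q = 0 \/ (q' - q < 0 \/ 0 < q' - q)%R; [lia|lia|nia|nia].
Qed.

End Colouring.

End RootedTree.

Section ColouringExistence.
Variable G : graph.
Implicit Types u v w : G.

Lemma numbering_neighbours D : (forall u, (nbhd u #<= `I_D)%card) ->
  exists s : G -> G -> nat, forall u,
    (forall a, adj u a -> (s u a < D)%N) /\
    (forall a b, adj u a -> adj u b -> s u a = s u b -> a = b).
Proof.
move=> deg; have [u|s sP] := @boolp.choice _ _ (fun u (su : G -> nat) =>
  (forall a, adj u a -> (su a < D)%N) /\
  (forall a b, adj u a -> adj u b -> su a = su b -> a = b)); last by exists s.
have /pcard_leP[f] := deg u; exists f; split=> [a ua|a b ua ub].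
  exact: (@funS _ _ _ _ f a ua).
by apply: (@inj _ _ (nbhd u) f); rewrite in_setE.
Qed.

(** [ev] selects the even levels.  Letting the window of neighbouring colours
    extend to the right at one class of the bipartition and to the left at the
    other makes the two window conditions of an edge one and the same, so that
    the choices made at different vertices do not conflict. *)
Lemma tree_colouring D : is_tree G -> (0 < D)%N -> G ->
  (forall u, (nbhd u #<= `I_D)%card) ->
  exists (ev : pred G) (c : G -> int),
    [/\ forall u v, adj u v -> ev v = ~~ ev u,
        forall u v, adj u v -> ev u -> 0 <= c v - c u <= D%:Z - 1
      & forall w u v, adj w u -> adj w v -> u != v -> c u != c v].
Proof.
move=> G_tree D_gt0 r /numbering_neighbours[s sP].
exists (fun v => ~~ odd (lev r G_tree v)), (colour r G_tree D s); split.
- by move=> u v /(odd_lev_adj r G_tree)->.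
- by move=> u v; apply: colour_window.
- by move=> w u v; have [sD s_inj] := sP w; apply: colour_neq.
Qed.

End ColouringExistence.

(** * From the colouring to an elegant labelling *)

Lemma cnormN l (x : int) : cnorm l (- x) = cnorm l x.
Proof. by rewrite /cnorm normrN. Qed.

(** As [0 <= x - y <= l], the residues differ by [x - y] or by [x - y - l]. *)
Lemma cnorm_mod l k (x y : int) : k%:Z <= x - y <= l%:Z - k%:Z ->
  k%:Z <= cnorm l ((x %% l%:Z)%Z - (y %% l%:Z)%Z).
Proof.
case: (posnP l) => [->|l0]; first by rewrite !modz0 /cnorm; lia.
have l0' : 0 < l%:Z by rewrite ltz_nat.
have := (divz_eq x l%:Z, divz_eq y l%:Z).
have := (ltz_pmod x l0', ltz_pmod y l0').
have : 0 <= (x %% l%:Z)%Z /\ 0 <= (y %% l%:Z)%Z by rewrite !modz_ge0; lia.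
move: (x %/ _)%Z (y %/ _)%Z (x %% _)%Z (y %% _)%Z => q q' a b.
move=> [a0 b0] [al bl] [ex ey] kl.
have e : x - y = (q - q') * l%:Z + (a - b) by rewrite ex ey; ring.
rewrite e in kl; move: (q - q') kl => t kl; rewrite /cnorm.
have [t0|[t1|[t2|t3]]] : t = 0 \/ (t = 1 \/ (2 <= t \/ t <= - 1)) by lia.
- by rewrite t0 in kl; lia.
- by rewrite t1 in kl; lia.
- by have : 2 * l%:Z <= t * l%:Z; [rewrite ler_pM2r|lia].
- by have : t * l%:Z <= - 1 * l%:Z; [rewrite ler_pM2r|lia].
Qed.

Section Labelling.
Variables (G : graph) (D h p : nat).
Hypotheses (D_gt0 : (0 < D)%N) (p_gt0 : (0 < p)%N) (h_ge : (D * p <= h)%N).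
Variables (ev : pred G) (c : G -> int).
Hypothesis ev_adj : forall u v, adj u v -> ev v = ~~ ev u.
Hypothesis c_window : forall u v, adj u v -> ev u -> 0 <= c v - c u <= D%:Z - 1.
Hypothesis c_neq : forall w u v, adj w u -> adj w v -> u != v -> c u != c v.
Implicit Types u v w : G.

Let l := (2 * h + D * p - 1)%N.

Let l_gt0 : (0 < l)%N.
Proof. by rewrite /l; nia. Qed.

Let W := (D%:Z - 1) * p%:Z.

Let W_ge0 : 0 <= W. Proof. by rewrite /W; nia. Qed.
Let W_le : W + p%:Z <= h%:Z. Proof. by rewrite /W; nia. Qed.
Let lE : l%:Z = 2 * h%:Z + W + p%:Z - 1.
Proof. by rewrite /l /W; nia. Qed.

(** The label before reduction: scaling by [p] separates vertices at distance
    two, the shift by [h] separates the two classes of the bipartition. *)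
Definition position v : int := c v * p%:Z + (if ev v then 0 else h%:Z).

Lemma position_adj u v : adj u v -> ev u ->
  h%:Z <= position v - position u <= h%:Z + W.
Proof.
move=> uv eu; have := c_window uv eu.
by rewrite /position (ev_adj uv) eu /= /W; nia.
Qed.

Lemma position_sibling w u v : adj w u -> adj w v ->
  - W <= position u - position v <= W.
Proof.
move=> wu wv; rewrite /position (ev_adj wu) (ev_adj wv).
case ew : (ev w) => /=.
  by have := (c_window wu ew, c_window wv ew); rewrite /W => -[]; nia.
have [uw vw] : adj u w /\ adj v w by rewrite ![adj _ w]adj_sym.
have := (c_window uw, c_window vw).
by rewrite (ev_adj wu) (ev_adj wv) ew /W => -[/(_ isT) + /(_ isT)]; nia.
Qed.

Lemma position_sibling_gap w u v : adj w u -> adj w v -> u != v ->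
  p%:Z <= `|position u - position v|.
Proof.
move=> wu wv uv; have := c_neq wu wv uv.
by rewrite /position (ev_adj wu) (ev_adj wv); nia.
Qed.

Definition residue (x : int) : 'I_l.
Proof.
exists `|(x %% l%:Z)%Z|%N.
by have := @ltz_pmod x l%:Z; have := @modz_ge0 x l%:Z; lia.
Defined.

Lemma residueE x : (residue x : nat)%:Z = (x %% l%:Z)%Z.
Proof. by rewrite /=; have := @modz_ge0 x l%:Z; lia. Qed.

Definition mod_label v : 'I_l := residue (position v).

Lemma labelling_mod_label : labelling h p p mod_label.
Proof.
have sym k u v : k%:Z <= cnorm l ((mod_label u)%:Z - (mod_label v)%:Z) ->
    k%:Z <= cnorm l ((mod_label v)%:Z - (mod_label u)%:Z).
  by rewrite -cnormN opprB.
move=> u v; split=> [/dist_walk/walk1 uv|duv|/dist_walk/walkS].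
- wlog eu : u v uv / ev u => [IH|].
    case eu: (ev u); first exact: IH.
    by apply/sym/IH; rewrite 1?adj_sym// (ev_adj uv) eu.
  apply: sym; rewrite /mod_label !residueE; apply: cnorm_mod.
  by have := position_adj uv eu; lia.
- have uv : u != v by apply/eqP => e; move: duv; rewrite e dist_refl.
  have /walkS[w /walk1] := dist_walk duv; rewrite adj_sym => wu wv {duv}.
  wlog le_vu : u v wu wv uv / position v <= position u => [IH|].
    have [|/ltW] := leP (position v) (position u); first exact: IH.
    by rewrite eq_sym in uv; move=> ?; apply/sym/IH.
  rewrite /mod_label !residueE; apply: cnorm_mod.
  by have := (position_sibling wu wv, position_sibling_gap wu wv uv) => -[]; lia.
- (* On a walk u, x, y, v with [ev x], the three steps bound the difference. *)
  case=> y /walkS[x /walk1 ux xy] yv.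
  wlog ex : u x y v ux xy yv / ev x => [IH|].
    case ex : (ev x); first exact: (IH u x y v).
    apply/sym/(IH v y x u); rewrite 1?adj_sym// (ev_adj xy) ex//.
  have ey : ev v by rewrite (ev_adj yv) (ev_adj xy) ex.
  rewrite /mod_label !residueE; apply: cnorm_mod.
  have vy : adj v y by rewrite adj_sym.
  have xu : adj x u by rewrite adj_sym.
  have yx : adj y x by rewrite adj_sym.
  have := (position_adj xu ex, position_adj vy ey, position_adj xy ex).
  by have := (position_sibling xu xy, position_sibling yx yv) => -[? ?] [[]]; lia.
Qed.

Definition window_start v : int :=
  position v + (if ev v then h%:Z else - h%:Z - W).

Lemma position_window u v : adj u v ->
  window_start u <= position v <= window_start u + W.
Proof.
move=> uv; rewrite /window_start; case eu: (ev u).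
  by have := position_adj uv eu; lia.
have vu : adj v u by rewrite adj_sym.
by have := position_adj vu; rewrite (ev_adj uv) eu => /(_ isT); lia.
Qed.

(** For an edge [uv] with [u] in the first class, the window of [u] extends to
    the right of [u] and that of [v] to the left of [v]; their points differ by
    at least [h - W > 0] and by at most [h + 2 * W < l]. *)
Lemma windows_disjoint u v (i j : int) : adj u v ->
  window_start u <= i <= window_start u + W ->
  window_start v <= j <= window_start v + W -> (i %% l%:Z)%Z != (j %% l%:Z)%Z.
Proof.
move=> uv; wlog eu : u v i j uv / ev u => [IH|].
  case eu: (ev u) => iu jv; first exact: (IH u v).
  by rewrite eq_sym (IH v u j i) 1?adj_sym// (ev_adj uv) eu.
rewrite /window_start (ev_adj uv) eu /= => iu jv.
have := position_adj uv eu => bnd; apply/eqP => e.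
(* Equal residues would be at cyclic distance zero. *)
have := @cnorm_mod l 1 i j; rewrite e subrr /cnorm normr0.
by rewrite lE; lia.
Qed.

Lemma elegant_mod_label : elegant mod_label.
Proof.
exists (fun u => [set x | exists2 j : int,
  window_start u <= j <= window_start u + W & (x : nat)%:Z = (j %% l%:Z)%Z]%classic).
split=> [u|u v uv]; last first.
  apply/seteqP; split=> x //= -[[i iu xi] [j jv xj]].
  by have /eqP := windows_disjoint uv iu jv; rewrite -xi -xj.
split; first by exists (window_start u), (window_start u + W); split=> //; lia.
move=> _ [v uv <-]; exists (position v); first exact: position_window.
exact: residueE.
Qed.

End Labelling.

Lemma elegant_labelling_of_tree (G : graph) (D h p : nat) : is_tree G ->
  max_degree G D -> (0 < D)%N -> (0 < p)%N -> (D * p <= h)%N ->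
  exists f : G -> 'I_(2 * h + D * p - 1), labelling h p p f /\ elegant f.
Proof.
move=> G_tree [[r _] deg] D0 p0 Dph.
have [ev [c [ev_adj c_win c_neq]]] := tree_colouring G_tree D0 r deg.
exists (mod_label D0 p0 Dph ev c); split.
  exact: labelling_mod_label.
exact: elegant_mod_label.
Qed.

(** * The lower bound *)

Lemma tree_triangle_free (G : graph) (w u v : G) : is_tree G ->
  adj w u -> adj w v -> ~~ adj u v.
Proof.
move=> G_tree wu wv; apply/negP => uv.
have := (odd_lev_adj w G_tree wu, odd_lev_adj w G_tree wv).
by rewrite (odd_lev_adj w G_tree uv) => -[->]; case: odd.
Qed.

(** Measured cyclically from the label of a vertex, the labels of its
    neighbours lie between [h] and [l - h] and are pairwise [p] apart, so that
    division by [p] separates them. *)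
Lemma star_span (G : graph) (D h p l : nat) (f : G -> 'I_l) (v : G) :
  is_tree G -> (0 < D)%N -> (0 < p)%N -> (p <= h)%N ->
  (nbhd v #= `I_D)%card -> labelling h p p f -> (2 * h + (D - 1) * p <= l)%N.
Proof.
move=> G_tree D0 p0 ph deg fP.
pose off w : nat := if (f v <= f w)%N then (f w - f v)%N else (f w + l - f v)%N.
have off_range w : adj v w -> (h <= off w)%N /\ (off w + h <= l)%N.
  move=> vw; have [/(_ (dist_adj vw)) + _ _] := fP v w.
  have := ltn_ord (f v); have := ltn_ord (f w).
  by rewrite /off /cnorm; case: (leqP (f v) (f w)); lia.
have off_gap u w : adj v u -> adj v w -> u != w ->
    (off u + p <= off w)%N \/ (off w + p <= off u)%N.
  move=> vu vw uw.
  have [_ + _] := fP u w.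
  move=> /(_ (dist2 vu vw uw (tree_triangle_free G_tree vu vw))).
  have := ltn_ord (f v); have := ltn_ord (f u); have := ltn_ord (f w).
  rewrite /off /cnorm.
  by case: (leqP (f v) (f u)); case: (leqP (f v) (f w)); lia.
have [g [_ _ g_surj]] := card_set_bijP deg.
have [u vu _] := g_surj 0%N D0.
have [hu ul] := off_range u vu.
suff : (D <= ((l - 2 * h) %/ p).+1)%N.
  by rewrite -[D]prednK// ltnS leq_divRL//; lia.
rewrite -card_le_II -(card_le_eql deg); apply/pcard_leP/injfunPex.
exists (fun w => ((off w - h) %/ p)%N) => [w vw|a b].
  by rewrite /= ltnS leq_div2r//; have := off_range w vw; lia.
rewrite !in_setE => va vb /eqP e; apply/eqP; move: e; apply: contraLR => ab.
have [[ha _] [hb _]] := (off_range a va, off_range b vb).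
have ltn_div x y : (x + p <= y)%N -> (x %/ p < y %/ p)%N.
  move=> xy; apply: leq_trans (leq_div2r p xy).
  by rewrite divnDr ?dvdnn// divnn p0 addn1.
case: (off_gap a b va vb ab) => lt; rewrite neq_ltn.
  by rewrite ltn_div//; lia.
by rewrite orbC ltn_div//; lia.
Qed.

(** * The bounds for trees of given maximum degree *)

Local Open Scope ereal_scope.

Lemma tree_sigma_bounds (G : graph) (D h p : nat) : is_tree G ->
  max_degree G D -> (0 < D)%N -> (0 < p)%N -> (D * p <= h)%N ->
  [/\ (2 * h%:Z + (D%:Z - 1) * p%:Z)%:E <= sigma G h p p,
      sigma G h p p <= sigma_star G h p p
    & sigma_star G h p p <= (2 * h%:Z + D%:Z * p%:Z - 1)%:E].
Proof.
move=> G_tree deg D0 p0 Dph; split.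
- apply: le_emin => l [_ [f fP]]; rewrite lee_fin.
  have [[v dv] _] := deg; have ph : (p <= h)%N by nia.
  by have := star_span G_tree D0 p0 ph dv fP; nia.
- by apply: le_emin => l [l0 [f [fP _]]]; apply: emin_le; split=> //; exists f.
- have -> : (2 * h%:Z + D%:Z * p%:Z - 1 = (2 * h + D * p - 1)%N%:Z)%R by nia.
  apply: emin_le; split; first by nia.
  exact: elegant_labelling_of_tree.
Qed.

Local Close Scope ereal_scope.

(** * Maximum degrees of complete and regular trees *)

Section AddOnePoint.
Local Open Scope classical_set_scope.
Variables (T : eqType) (A : set T) (a : T) (n : nat).

Lemma set_inj_setU1 (f : T -> nat) : set_fun A `I_n f -> set_inj A f ->
  let g x := if x == a then n else f x in
  set_fun (a |` A) `I_n.+1 g /\ set_inj (a |` A) g.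
Proof.
move=> fA f_inj; have lt x : A x -> (f x < n)%N := fA x.
split=> [x|x y].
  by case: eqP => [_ _ /=|ne [//|/lt] /=]; [rewrite ltnS|exact: ltnW].
rewrite !in_setE => xA yA; case: (eqVneq x a) (eqVneq y a) => [->|nx] [->|ny] //.
- by case: yA => [e|/lt]; [rewrite e eqxx in ny|lia].
- by case: xA => [e|/lt]; [rewrite e eqxx in nx|lia].
case: xA yA => [e|xA] [e'|yA]; rewrite ?e ?e' ?eqxx// in nx ny.
by apply: f_inj; rewrite in_setE.
Qed.

Lemma card_le_setU1 : (A #<= `I_n)%card -> (a |` A #<= `I_n.+1)%card.
Proof.
move=> /pcard_leP/injfunPex[f fA f_inj]; apply/pcard_leP/injfunPex.
have [gA g_inj] := set_inj_setU1 fA f_inj.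
by exists (fun x => if x == a then n else f x).
Qed.

Lemma card_eq_setU1 : ~ A a -> (A #= `I_n)%card -> (a |` A #= `I_n.+1)%card.
Proof.
move=> Aa /card_set_bijP[f [fA f_inj f_surj]]; apply/card_set_bijP.
have [gA g_inj] := set_inj_setU1 fA f_inj.
exists (fun x => if x == a then n else f x); split=> // i /=.
rewrite ltnS leq_eqVlt => /predU1P[->|lt_in].
  by exists a; [left|rewrite eqxx].
have [x xA <-] := f_surj i lt_in; exists x; first by right.
by case: eqP => // e; rewrite e in xA.
Qed.

End AddOnePoint.

Section RootedDegrees.
Variables (G : graph) (r : G) (G_tree : is_tree G) (m : nat).
Local Open Scope classical_set_scope.
Local Notation lev := (lev r G_tree).
Local Notation par := (par r G_tree).
Implicit Types v w : G.

Lemma childrenP v w : children r v w <-> adj v w /\ lev w = (lev v).+1.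
Proof.
rewrite /children /= !(level_lev r G_tree) -EFinD.
by split=> -[vw e]; split=> //; [case: e; lia|rewrite e; congr (_%:E); lia].
Qed.

Lemma nbhd_root : nbhd r = children r r.
Proof.
apply/seteqP; split=> w; last by case/childrenP.
move=> rw; apply/childrenP; split=> //.
case: (adj_par r G_tree rw) => -[nw e]; last by rewrite eqxx in nw.
by have [_] := par_adj G_tree nw; rewrite e.
Qed.

Lemma nbhd_nonroot v : v != r -> nbhd v = par v |` children r v.
Proof.
move=> vr; have [pv ev] := par_adj G_tree vr; apply/seteqP; split=> w.
  move=> vw; case: (adj_par r G_tree vw) => -[nw e]; last by left; rewrite e.
  right; apply/childrenP; split=> //.
  by have [_] := par_adj G_tree nw; rewrite e.
by case=> [->|/childrenP[]//]; rewrite /nbhd /= adj_sym.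
Qed.

Lemma par_notin_children v : v != r -> ~ children r v (par v).
Proof.
by move=> /(par_adj G_tree)[_ ev] /childrenP[_]; lia.
Qed.

Lemma max_degree_rooted :
  (exists2 v, v != r & (children r v #= `I_m)%card) ->
  (forall v, (children r v #<= `I_m)%card) -> max_degree G m.+1.
Proof.
move=> [v vr dv] deg; split.
  exists v; rewrite nbhd_nonroot//.
  exact: card_eq_setU1 (par_notin_children vr) dv.
move=> u; have [->|ur] := eqVneq u r; last first.
  by rewrite nbhd_nonroot//; apply: card_le_setU1.
by rewrite nbhd_root (card_le_trans (deg r))// card_le_II.
Qed.

End RootedDegrees.

Lemma card_eq_II_nonempty (T : Type) (A : set T) m : (0 < m)%N ->
  (A #= `I_m)%card -> exists x, A x.
Proof.
move=> m0 /card_set_bijP[f [_ _ f_surj]].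
by have [x Ax _] := f_surj 0%N m0; exists x.
Qed.

Lemma level_child (G : graph) (r v : G) : is_tree G -> children r r v ->
  v != r /\ level r v = 1%:Z%:E.
Proof.
move=> G_tree /(childrenP r G_tree)[rv e].
by rewrite eq_sym adj_neq// (level_lev r G_tree) e lev_root.
Qed.

(** The height being at least two, neither the root nor its children are leaves,
    so a child of the root has a parent and [m] children. *)
Lemma max_degree_T_fin m k (G : graph) : (0 < m)%N -> (1 < k)%N ->
  is_T_fin m k G -> max_degree G m.+1.
Proof.
move=> m0 k1 [G_tree _ [r [deg leaf_level]]].
have inner v n : level r v = n%:Z%:E -> (n < k)%N ->
    (children r v #= `I_m)%card.
  by move=> lv nk; apply: deg => /leaf_level; rewrite lv => -[]; lia.
have dr : (children r r #= `I_m)%card.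
  by apply: (inner r 0%N); [exact: dist_refl|exact: ltnW].
have [v /(level_child G_tree)[vr lv]] := card_eq_II_nonempty m0 dr.
apply: (@max_degree_rooted _ r) => //; first by exists v => //; apply: inner lv k1.
move=> w; have [->|/deg/card_eqPle[]//] := pselect (leaf r w).
exact: card_ge0.
Qed.

Lemma max_degree_T_inf m (G : graph) : (0 < m)%N ->
  is_T_inf m G -> max_degree G m.+1.
Proof.
move=> m0 [G_tree _ [r deg]].
have [v /(level_child G_tree)[vr _]] := card_eq_II_nonempty m0 (deg r).
apply: (@max_degree_rooted _ r) => //; first by exists v.
by move=> w; have /card_eqPle[] := deg w.
Qed.

Lemma max_degree_hatT_inf m (G : graph) : is_hatT_inf m G -> max_degree G m.+1.
Proof.
move=> [_ /infinite_setN0[v _] deg]; split; first by exists v.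
by move=> w; have /card_eqPle[] := deg w.
Qed.

(** * Balls in trees *)

Section Ball.
Variables (H : graph) (H_tree : is_tree H) (c : H) (k : nat).
Local Notation B := (ball c k).

Lemma in_ball v : `[< (dist c v <= k%:Z%:E)%E >] = (lev c H_tree v <= k)%N.
Proof.
by rewrite -/(level c v) (level_lev c H_tree) lee_fin lez_nat asboolb.
Qed.

Definition ball_centre : B.
Proof. by exists c; rewrite in_ball lev_root. Defined.

(** The lower neighbours of a vertex of the ball stay in the ball. *)
Lemma ball_walk_from_centre (v : B) :
  walk ball_centre v (lev c H_tree (val v)).
Proof.
move e : (lev _ _ _) => n; elim: n v e => [|n IHn] v e.
  by rewrite (_ : v = ball_centre); [exact: walk0|apply/val_inj/(lev_eq0 e)].
have [u uv eu] := lower_neighbour e.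
have uB : `[< (dist c u <= k%:Z%:E)%E >].
  by have := valP v; rewrite !in_ball; lia.
by apply/walkS; exists (Sub u uB : B) => //; apply: IHn.
Qed.

Lemma ball_is_tree : is_tree B.
Proof.
split=> [u v|s /andP[cs us]].
  have [wu wv] := (ball_walk_from_centre u, ball_walk_from_centre v).
  exists (lev c H_tree (val u) + lev c H_tree (val v))%N.
  exact: walk_cat (walk_sym wu) wv.
rewrite -(size_map val); apply: H_tree.2.
by rewrite /ucycle cycle_map (map_inj_uniq val_inj) us andbT.
Qed.

Lemma max_degree_ball D : (0 < k)%N -> (forall v : H, (nbhd v #= `I_D)%card) ->
  max_degree B D.
Proof.
move=> k0 deg; split; last first.
  move=> v; have /card_set_bijP[f [fA f_inj _]] := deg (val v).
  apply/pcard_leP/injfunPex; exists (f \o val) => [w vw|a b]; first exact: fA.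
  rewrite !in_setE => va vb /f_inj e.
  by apply/val_inj/e; rewrite in_setE.
exists ball_centre; apply/card_set_bijP.
have /card_set_bijP[f [fA f_inj f_surj]] := deg c.
exists (f \o val); split=> [w cw|a b|i iD]; first exact: fA.
  rewrite !in_setE => va vb /f_inj e.
  by apply/val_inj/e; rewrite in_setE.
have [w cw fw] := f_surj i iD.
have wB : `[< (dist c w <= k%:Z%:E)%E >].
  by rewrite in_ball; have := lev_adj c H_tree cw; rewrite lev_root; lia.
by exists (Sub w wB : B).
Qed.

End Ball.

Lemma complete_tree_max_degree m k (T : graph) : (0 < m)%N -> (1 < k)%N ->
  [\/ is_T_fin m k T, is_T_inf m T, is_hatT_fin m k T | is_hatT_inf m T] ->
  is_tree T /\ max_degree T m.+1.
Proof.
move=> m0 k1 [TT|TT|[H [c [HT ->]]]|TT].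
- by split; [case: TT|apply: max_degree_T_fin TT].
- by split; [case: TT|apply: max_degree_T_inf TT].
- case: HT => H_tree _ deg; split; first exact: ball_is_tree.
  by apply: max_degree_ball => //; apply: ltnW.
- by split; [case: TT|apply: max_degree_hatT_inf TT].
Qed.

Local Open Scope ereal_scope.

Theorem theorem4p1 (h p : nat) (h_ge1 : (1 <= h)%N) (p_ge1 : (1 <= p)%N) :
  (forall (T : graph) (Delta : nat),
     is_tree T ->
     (finite_graph T /\ 3%:Z%:E <= diameter T) \/ infinite_graph T ->
     max_degree T Delta -> (3 <= Delta)%N ->
     (Delta * p <= h)%N ->
     [/\ (2 * h%:Z + (Delta%:Z - 1) * p%:Z)%:E <= sigma T h p p,
         sigma T h p p <= sigma_star T h p p
       & sigma_star T h p p <= (2 * h%:Z + Delta%:Z * p%:Z - 1)%:E])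
  /\
  (forall (m k : nat) (T : graph),
     (2 <= m)%N -> (2 <= k)%N ->
     [\/ is_T_fin m k T, is_T_inf m T, is_hatT_fin m k T | is_hatT_inf m T] ->
     ((m + 1) * p <= h)%N ->
     [/\ (2 * h%:Z + m%:Z * p%:Z)%:E <= sigma T h p p,
         sigma T h p p <= sigma_star T h p p
       & sigma_star T h p p <= (2 * h%:Z + (m%:Z + 1) * p%:Z - 1)%:E]).
Proof.
split=> [T Delta T_tree _ deg Delta3|m k T m2 k2 T_family] Dph.
  by apply: tree_sigma_bounds => //; apply: ltnW (ltnW _).
have [T_tree deg] := complete_tree_max_degree (ltnW m2) k2 T_family.
rewrite addn1 in Dph; have := tree_sigma_bounds T_tree deg isT p_ge1 Dph.
have -> : m.+1%:Z = (m%:Z + 1)%R by rewrite -addn1.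
by rewrite addrK.
Qed.
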